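(* Let $T>\Delta_S>0$, $B_W,\gamma,N,Q_B,\eta>0$ and $\xi_a\in(0,1]$, put $V=1-(1+\gamma)^{-2}$ and $D_{\max}=\lfloor(T-\Delta_S)B_W\rfloor$, and assume $D_{\max}\ge1$. Define $$\psi_T(D)=\ln(2)\,\eta\sqrt{\frac{D}{V}}\left(\log_2(1+\gamma)-\frac{Q_BN}{D}\right),\qquad \tilde\nu_{\mathsf{mv}}(D)=\frac{(T-\Delta_S)B_W\,\xi_a}{D\left(1+\exp(-\psi_T(D))\right)},$$ $$f_{\mathbf{mv}}(D)=\frac{\eta\ln(2)\left(\log_2(1+\gamma)+NQ_B/D\right)}{2\sqrt{DV}\left(\exp(\psi_T(D))+1\right)}-\frac1D .$$ If $f_{\mathbf{mv}}(1)\cdot f_{\mathbf{mv}}(D_{\max})<0$, then the optimal packet length $D^*$ of the problem $$\max_D\ \tilde\nu_{\mathsf{mv}}(D)\quad\text{subject to}\quad D\in\{1,2,\dots,D_{\max}\}$$ can be obtained as $$D^*=\left\lfloor\frac{V\zeta^2}{\ln^2(2)\,\eta^2\log_2^2(1+\gamma)}\right\rceil_{\tilde\nu_{\mathsf{mv}}(\cdot)},$$ where $\lfloor x\rceil_{\tilde\nu_{\mathsf{mv}}(\cdot)}$ equals $\lfloor x\rfloor$ if $\tilde\nu_{\mathsf{mv}}(\lfloor x\rfloor)\ge\tilde\nu_{\mathsf{mv}}(\lceil x\rceil)$ and equals $\lceil x\rceil$ otherwise, and $\zeta$ is the solution $x>0$ of the transcendental equation $$x+\frac{\omega}{x}-2\exp\left(x-\frac{\omega}{x}\right)=2,\qquad\text{with}\quad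 \omega=\frac{\ln^2(2)\,\eta^2}{V}\,\log_2(1+\gamma)\,NQ_B .$$
   Context: Notation: $\ln^2(2)=(\ln 2)^2$ and $\log_2^2(1+\gamma)=(\log_2(1+\gamma))^2$. Interpretation (not needed for the claim): $T$ is the deadline, $\Delta_S$ the sensing time, $B_W$ the bandwidth, $\gamma$ the SNR, $N$ the feature dimension, $Q_B$ the number of bits per feature, $\xi_a$ the sensor activation probability, $\eta$ a fitting coefficient (the paper uses $\eta=1.7$) in the approximation $Q(x)\approx1-1/(1+e^{-\eta x})$ of the Gaussian Q-function, and $\tilde\nu_{\mathsf{mv}}(D)$ approximates the expected number of views successfully transmitted within the deadline with packet length $D$. *)

(* Defs.v *)
From Stdlib Require Import Reals ZArith Zfloor.
Open Scope R_scope.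

(* Parameters, in this order throughout: deadline T, sensing time DeltaS,
   bandwidth BW, SNR gamma, feature dimension N, bits per feature QB,
   activation probability xi_a, fitting coefficient eta.
   All of them, including N and QB, are arbitrary reals here. *)

Definition log2 (x : R) : R := Rlog 2 x.

Definition V (gamma : R) : R := 1 - / (1 + gamma) ^ 2.

Definition Dmax (T DeltaS BW : R) : Z := Zfloor ((T - DeltaS) * BW).

Definition psi_T (gamma N QB eta D : R) : R :=
  ln 2 * eta * sqrt (D / V gamma) * (log2 (1 + gamma) - QB * N / D).

Definition nu_mv (T DeltaS BW gamma N QB xi_a eta D : R) : R :=
  (T - DeltaS) * BW * xi_a / (D * (1 + exp (- psi_T gamma N QB eta D))).

Definition f_mv (gamma N QB eta D : R) : R :=
  eta * ln 2 * (log2 (1 + gamma) + N * QB / D)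
    / (2 * sqrt (D * V gamma) * (exp (psi_T gamma N QB eta D) + 1))
  - 1 / D.

Definition omega (gamma N QB eta : R) : R :=
  (ln 2) ^ 2 * eta ^ 2 / V gamma * log2 (1 + gamma) * N * QB.

Definition transcendental_solution (w x : R) : Prop :=
  0 < x /\ x + w / x - 2 * exp (x - w / x) = 2.

Definition round_by (g : R -> R) (x : R) : Z :=
  if Rge_dec (g (IZR (Zfloor x))) (g (IZR (Zceil x)))
  then Zfloor x else Zceil x.

Definition optimal_length (g : R -> R) (m D : Z) : Prop :=
  (1 <= D <= m)%Z /\ forall k : Z, (1 <= k <= m)%Z -> g (IZR k) <= g (IZR D).

(* Main.v *)
Require Import Defs.
From Stdlib Require Import Reals ZArith.
From Stdlib Require Import Zfloor Lra Lia.
From Coquelicot Require Import Coquelicot.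
Open Scope R_scope.

(** Substitute [x = s sqrt D] with [s = ln 2 eta log2 (1 + gamma) / sqrt V].
    Then [psi_T D = x - omega / x], maximising [nu_mv] amounts to minimising
    [cost x = x^2 (1 + exp (- (x - omega / x)))], and both [cost' x] and
    [- f_mv D] have the sign of [- gap x], where
    [gap x = x + omega / x - 2 exp (x - omega / x) - 2].  As [gap] is strictly
    decreasing, the sign change of [f_mv] yields a unique zero [zeta] of [gap],
    and [nu_mv] increases up to [D = (zeta / s)^2] and decreases afterwards. *)

(** * The transcendental equation and its unique positive root *)

Definition gap (w x : R) : R := x + w / x - 2 * exp (x - w / x) - 2.

Definition cost (w x : R) : R := x ^ 2 * (1 + exp (- (x - w / x))).

Lemma transcendental_solution_gap (w x : R) :
  transcendental_solution w x <-> 0 < x /\ gap w x = 0.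
Proof. unfold transcendental_solution, gap; split; intros [? ?]; split; lra. Qed.

(** For [u >= 0] the slope of [exp] is at least 1 beyond [u]. For [u < 0],
    [exp v - exp u > (1 + v) - 1 = v], and [2 v > v - u] because [u + v > 0]. *)
Lemma exp_sub_lower (u v : R) :
  u < v -> 0 < u + v -> v - u < 2 * (exp v - exp u).
Proof.
  intros Huv Hs.
  destruct (Rle_or_lt 0 u) as [Hu|Hu].
  - pose proof (exp_ineq1_le (v - u)).
    assert (1 <= exp u) by (pose proof (exp_ineq1_le u); lra).
    replace (exp v) with (exp u * exp (v - u))
      by (rewrite <- exp_plus; f_equal; ring).
    nra.
  - pose proof (exp_ineq1_le v).
    assert (exp u < 1) by (rewrite <- exp_0; now apply exp_increasing).
    lra.
Qed.

(** With [t = w / (x y)], the arguments of [exp] are [u = x - t y] and [v = y - t x], so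
    [v - u = (1 + t) (y - x)] and [u + v = (1 - t) (x + y)], while the rational part of [gap]
    changes by [(1 - t) (y - x)]. For [t >= 1] this change is not positive and the growth of [exp]
    suffices; for [t < 1], [exp_sub_lower] shows that the exponential term outweighs it. *)
Lemma gap_decreasing (w x y : R) :
  0 < w -> 0 < x -> x < y -> gap w y < gap w x.
Proof.
  intros Hw Hx Hxy.
  set (t := w / (x * y)).
  assert (Hxy0 : 0 < x * y) by nra.
  assert (Ht : 0 < t) by now apply Rdiv_lt_0_compat.
  assert (Hwx : w / x = t * y) by (unfold t; field; lra).
  assert (Hwy : w / y = t * x) by (unfold t; field; lra).
  unfold gap; rewrite Hwx, Hwy.
  assert (Huv : x - t * y < y - t * x) by nra.
  destruct (Rle_or_lt t 1) as [H1|H1].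
  - destruct H1 as [H1|H1].
    + pose proof (exp_sub_lower _ _ Huv ltac:(nra)). nra.
    + pose proof (exp_increasing _ _ Huv). subst t; rewrite H1 in *; lra.
  - pose proof (exp_increasing _ _ Huv). nra.
Qed.

Lemma gap_continuity_pt (w x : R) : 0 < x -> continuity_pt (gap w) x.
Proof.
  intros Hx.
  apply derivable_continuous_pt, ex_derive_Reals_0.
  unfold gap; auto_derive; lra.
Qed.

Lemma gap_unique_zero (w a b : R) :
  0 < w -> 0 < a -> a < b -> 0 < gap w a -> gap w b < 0 ->
  exists z, a <= z <= b /\ unique (transcendental_solution w) z.
Proof.
  intros Hw Ha Hab Hga Hgb.
  (* [IVT_interv] expects a change from negative to positive, hence the negation. *)
  destruct (Ranalysis5.IVT_interv (fun x => - gap w x) a b) as [z [Hz Hgz]];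
    [ | lra .. | ].
  { intros c Hc. apply (continuity_pt_opp (gap w)), gap_continuity_pt. lra. }
  exists z; split; [lra|]; split.
  - apply transcendental_solution_gap; lra.
  - intros y [Hy Hgy]%transcendental_solution_gap.
    destruct (Rtotal_order z y) as [H|[H|H]]; [|easy|].
    + pose proof (gap_decreasing w z y Hw ltac:(lra) H). lra.
    + pose proof (gap_decreasing w y z Hw Hy H). lra.
Qed.

(** * Monotonicity of the cost on each side of the root *)

Lemma cost_derivable_pt_lim (w x : R) :
  0 < x ->
  derivable_pt_lim (cost w) x (- (x * exp (- (x - w / x)) * gap w x)).
Proof.
  intros Hx. apply is_derive_Reals. unfold cost.
  auto_derive; [lra|].
  unfold gap.
  (* This leaves a single exponential, which [field] treats as an atom. *)
  replace (exp (x - w / x)) with (/ exp (- (x - w / x)))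
    by (rewrite exp_Ropp, Rinv_inv; reflexivity).
  pose proof (exp_pos (- (x - w / x))).
  unfold Rminus, Rdiv in *. simpl. field. split; lra.
Qed.

Lemma cost_pos (w x : R) : 0 < x -> 0 < cost w x.
Proof.
  intros Hx. unfold cost. pose proof (exp_pos (- (x - w / x))). nra.
Qed.

(** By the mean value theorem the increment has the sign of [- gap w c] for some [c] strictly
    between [x] and [y]; since [c > z], [gap w c] is negative. *)
Lemma cost_le_after (w z x y : R) :
  0 < w -> 0 < z -> gap w z = 0 -> z <= x <= y -> cost w x <= cost w y.
Proof.
  intros Hw Hz Hg [Hzx [Hxy| ->]]; [|lra].
  destruct (MVT_cor2 (cost w) _ x y Hxy
    (fun c Hc => cost_derivable_pt_lim w c ltac:(lra))) as [c [Heq Hc]].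
  pose proof (gap_decreasing w z c Hw Hz ltac:(lra)).
  assert (0 < c * exp (- (c - w / c)))
    by (apply Rmult_lt_0_compat; [lra | apply exp_pos]).
  assert (c * exp (- (c - w / c)) * gap w c < 0) by nra.
  nra.
Qed.

Lemma cost_ge_before (w z x y : R) :
  0 < w -> gap w z = 0 -> 0 < x -> x <= y <= z -> cost w y <= cost w x.
Proof.
  intros Hw Hg Hx [[Hxy| ->] Hyz]; [|lra].
  destruct (MVT_cor2 (cost w) _ x y Hxy
    (fun c Hc => cost_derivable_pt_lim w c ltac:(lra))) as [c [Heq Hc]].
  pose proof (gap_decreasing w c z Hw ltac:(lra) ltac:(lra)).
  assert (0 < c * exp (- (c - w / c)))
    by (apply Rmult_lt_0_compat; [lra | apply exp_pos]).
  assert (0 < c * exp (- (c - w / c)) * gap w c) by nra.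
  nra.
Qed.

(** * Rounding the real maximiser of a unimodal function *)

Lemma round_by_optimal (g : R -> R) (p : R) (m : Z) :
  1 <= p <= IZR m ->
  (forall x y, 0 < x -> x <= y <= p -> g x <= g y) ->
  (forall x y, p <= x <= y -> g y <= g x) ->
  optimal_length g m (round_by g p).
Proof.
  intros Hp Hincr Hdecr.
  pose proof (Zfloor_bound p) as Hfl.
  pose proof (Zceil_bound p) as Hce.
  assert (Hf1 : (1 <= Zfloor p)%Z) by (apply Zfloor_lub; lra).
  assert (Hfc : (Zfloor p <= Zceil p)%Z) by (apply le_IZR; lra).
  (* By integrality, [Zceil p < p + 1 <= m + 1] suffices. *)
  assert (Hcm : (Zceil p <= m)%Z)
    by (apply Z.lt_succ_r, lt_IZR; rewrite succ_IZR; lra).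
  (* An integer up to [p] is at most [Zfloor p], and one beyond [p] is at least [Zceil p], so each
     [k] is dominated by one of the two candidates that [round_by] compares. *)
  assert (Hk : forall k : Z, (1 <= k)%Z ->
    g (IZR k) <= g (IZR (Zfloor p)) \/ g (IZR k) <= g (IZR (Zceil p))).
  { intros k Hk1. apply IZR_le in Hk1.
    destruct (Rle_or_lt (IZR k) p) as [Hkp|Hkp].
    - left. apply Hincr; [lra|]. split; [|lra].
      now apply IZR_le, Zfloor_lub.
    - right. apply Hdecr. split; [lra|].
      apply IZR_le, Z.lt_succ_r, lt_IZR. rewrite succ_IZR. lra. }
  unfold round_by, optimal_length.
  destruct Rge_dec as [Hge|Hge]; (split; [lia|]);
    intros k [Hk1 _]; destruct (Hk k Hk1); lra.
Qed.

(** * Positivity of the parameters and the change of variable *)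

Lemma V_pos (gamma : R) : 0 < gamma -> 0 < V gamma.
Proof.
  intros Hg. unfold V.
  assert (/ (1 + gamma) ^ 2 < 1); [|lra].
  rewrite <- Rinv_1. apply Rinv_lt_contravar; nra.
Qed.

Lemma ln2_pos : 0 < ln 2.
Proof. rewrite <- ln_1. apply ln_increasing; lra. Qed.

Lemma log2_pos (gamma : R) : 0 < gamma -> 0 < log2 (1 + gamma).
Proof.
  intros Hg. apply Rdiv_lt_0_compat; [|exact ln2_pos].
  rewrite <- ln_1. apply ln_increasing; lra.
Qed.

Definition scale (gamma eta : R) : R :=
  ln 2 * eta * log2 (1 + gamma) / sqrt (V gamma).

Section Substitution.

Variables gamma N QB eta : R.
Hypotheses (hgamma : 0 < gamma) (hN : 0 < N) (hQB : 0 < QB) (heta : 0 < eta).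

Local Notation s := (scale gamma eta).
Local Notation w := (omega gamma N QB eta).

Lemma scale_pos : 0 < scale gamma eta.
Proof.
  pose proof ln2_pos. pose proof (log2_pos gamma hgamma).
  apply Rdiv_lt_0_compat; [|apply sqrt_lt_R0, V_pos; assumption].
  repeat (assumption || apply Rmult_lt_0_compat).
Qed.

Lemma omega_pos : 0 < omega gamma N QB eta.
Proof.
  pose proof ln2_pos. pose proof (log2_pos gamma hgamma).
  pose proof (V_pos gamma hgamma).
  unfold omega, Rdiv.
  repeat (assumption || apply pow_lt || apply Rmult_lt_0_compat
          || apply Rinv_0_lt_compat).
Qed.

(** This identifies the quantity rounded in the theorem as [(zeta / s) ^ 2]. *)
Lemma scale_sq :
  scale gamma eta ^ 2
  = (ln 2) ^ 2 * eta ^ 2 * (log2 (1 + gamma)) ^ 2 / V gamma.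
Proof.
  pose proof (V_pos gamma hgamma) as HV.
  pose proof (sqrt_lt_R0 _ HV).
  unfold scale.
  (* Now [V gamma] occurs only through its square root, a single atom for [field]. *)
  rewrite <- (sqrt_sqrt (V gamma)) at 2 by lra.
  field. lra.
Qed.

Lemma omega_div_scale (D : R) :
  0 < D ->
  w / (s * sqrt D) = ln 2 * eta * (QB * N) / (sqrt (V gamma) * sqrt D).
Proof.
  intros HD.
  pose proof (V_pos gamma hgamma) as HV.
  pose proof (sqrt_lt_R0 _ HV). pose proof (sqrt_lt_R0 _ HD).
  pose proof ln2_pos. pose proof (log2_pos gamma hgamma).
  unfold omega, scale.
  rewrite <- (sqrt_sqrt (V gamma)) at 1 by lra.
  field. repeat split; lra.
Qed.

Lemma psi_T_substitution (D : R) :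
  0 < D ->
  psi_T gamma N QB eta D = s * sqrt D - w / (s * sqrt D).
Proof.
  intros HD.
  pose proof (V_pos gamma hgamma) as HV.
  pose proof (sqrt_lt_R0 _ HV). pose proof (sqrt_lt_R0 _ HD).
  rewrite omega_div_scale by assumption.
  unfold psi_T, scale.
  rewrite sqrt_div_alt by assumption.
  rewrite <- (sqrt_sqrt D) at 2 by lra.
  field. split; lra.
Qed.

(** With [x = s sqrt D], the first term of [f_mv] is [(x + w / x) / (2 D (exp psi + 1))]; putting
    [1 / D] over the same denominator subtracts [2 exp psi + 2], which leaves [gap w x] on top. *)
Lemma f_mv_substitution (D : R) :
  0 < D ->
  f_mv gamma N QB eta D
  = gap w (s * sqrt D) / (2 * D * (exp (psi_T gamma N QB eta D) + 1)).
Proof.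
  intros HD.
  pose proof (V_pos gamma hgamma) as HV.
  pose proof (sqrt_lt_R0 _ HV). pose proof (sqrt_lt_R0 _ HD).
  pose proof (exp_pos (psi_T gamma N QB eta D)).
  unfold f_mv, gap.
  rewrite <- psi_T_substitution, omega_div_scale, sqrt_mult_alt by lra.
  unfold scale.
  set (r := sqrt D) in *.
  replace D with (r * r) by (apply sqrt_sqrt; lra).
  (* The argument of [psi_T] is restored so that the exponential matches the positivity fact in the
     context. *)
  replace (psi_T gamma N QB eta (r * r)) with (psi_T gamma N QB eta D)
    by (unfold r; rewrite sqrt_sqrt; lra).
  field. repeat split; lra.
Qed.

Lemma nu_mv_substitution (T DeltaS BW xi_a D : R) :
  0 < D ->
  nu_mv T DeltaS BW gamma N QB xi_a eta D
  = (T - DeltaS) * BW * xi_a * s ^ 2 / cost w (s * sqrt D).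
Proof.
  intros HD.
  pose proof scale_pos as Hs.
  unfold nu_mv, cost.
  rewrite <- psi_T_substitution by assumption.
  pose proof (exp_pos (- psi_T gamma N QB eta D)).
  rewrite Rpow_mult_distr, pow2_sqrt by lra.
  field. repeat split; lra.
Qed.

Lemma f_mv_gap_sign (D : R) :
  0 < D ->
  exists c, 0 < c /\ f_mv gamma N QB eta D = c * gap w (s * sqrt D).
Proof.
  intros HD.
  exists (/ (2 * D * (exp (psi_T gamma N QB eta D) + 1))). split.
  - pose proof (exp_pos (psi_T gamma N QB eta D)).
    apply Rinv_0_lt_compat. nra.
  - rewrite f_mv_substitution by assumption. unfold Rdiv. ring.
Qed.

(** Up to positive factors the hypothesis says that the two gaps have opposite signs. This excludes
    [D = 1], where their product is a square, and for [D > 1] the decrease of [gap] decides which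
    one is positive. *)
Lemma gap_sign_change (D : R) :
  1 <= D ->
  f_mv gamma N QB eta 1 * f_mv gamma N QB eta D < 0 ->
  s < s * sqrt D /\ 0 < gap w s /\ gap w (s * sqrt D) < 0.
Proof.
  intros HD Hf.
  pose proof scale_pos as Hs.
  pose proof omega_pos as Hw.
  destruct (f_mv_gap_sign 1 ltac:(lra)) as [c1 [Hc1 E1]].
  destruct (f_mv_gap_sign D ltac:(lra)) as [c2 [Hc2 E2]].
  rewrite sqrt_1, Rmult_1_r in E1. rewrite E1, E2 in Hf.
  assert (Hprod : gap w s * gap w (s * sqrt D) < 0).
  { pose proof (Rmult_lt_0_compat _ _ Hc1 Hc2). nra. }
  destruct HD as [HD| <-].
  - assert (1 < sqrt D) by (rewrite <- sqrt_1; apply sqrt_lt_1; lra).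
    assert (Hlt : s < s * sqrt D) by nra.
    pose proof (gap_decreasing w _ _ Hw Hs Hlt).
    repeat split; nra.
  - rewrite sqrt_1, Rmult_1_r in Hprod. nra.
Qed.

End Substitution.

(** * Optimality of the rounded packet length *)

Theorem proposition3
  (T DeltaS BW gamma N QB xi_a eta : R)
  (hDeltaS : 0 < DeltaS) (hT : DeltaS < T)
  (hBW : 0 < BW) (hgamma : 0 < gamma) (hN : 0 < N) (hQB : 0 < QB)
  (heta : 0 < eta) (hxi : 0 < xi_a <= 1)
  (hDmax : (1 <= Dmax T DeltaS BW)%Z)
  (hf : f_mv gamma N QB eta 1
        * f_mv gamma N QB eta (IZR (Dmax T DeltaS BW)) < 0) :
  exists zeta : R,
    unique (transcendental_solution (omega gamma N QB eta)) zeta /\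
    optimal_length (nu_mv T DeltaS BW gamma N QB xi_a eta)
      (Dmax T DeltaS BW)
      (round_by (nu_mv T DeltaS BW gamma N QB xi_a eta)
         (V gamma * zeta ^ 2
          / ((ln 2) ^ 2 * eta ^ 2 * (log2 (1 + gamma)) ^ 2))).
Proof.
  set (m := Dmax T DeltaS BW) in *.
  apply IZR_le in hDmax.
  set (s := scale gamma eta).
  set (w := omega gamma N QB eta).
  assert (Hs : 0 < s) by now apply scale_pos.
  assert (Hw : 0 < w) by now apply omega_pos.
  destruct (gap_sign_change gamma N QB eta hgamma hN hQB heta (IZR m) hDmax hf)
    as [Hlt [Hg1 Hgm]].
  fold s w in Hlt, Hg1, Hgm.
  destruct (gap_unique_zero w _ _ Hw Hs Hlt Hg1 Hgm) as [zeta [Hz Huniq]].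
  exists zeta; split; [exact Huniq|].
  destruct Huniq as [[Hz0 Hgz]%transcendental_solution_gap _].
  replace (V gamma * zeta ^ 2 / _) with ((zeta / s) ^ 2).
  2: { replace ((zeta / s) ^ 2) with (zeta ^ 2 / s ^ 2) by (field; lra).
       unfold s. rewrite scale_sq by assumption.
       pose proof (V_pos gamma hgamma). pose proof ln2_pos.
       pose proof (log2_pos gamma hgamma).
       field. repeat split; lra. }
  (* The real maximiser is [q ^ 2]; the bracket [s <= zeta <= s * sqrt m] around the root becomes
     [1 <= q <= sqrt m]. *)
  set (q := zeta / s).
  assert (Hzq : zeta = s * q) by (unfold q; field; lra).
  assert (Hq1 : 1 <= q) by nra.
  assert (Hqm : q <= sqrt (IZR m)) by nra.
  assert (Hsq : sqrt (q ^ 2) = q) by (apply sqrt_pow2; lra).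
  (* [nu_mv] is a nonnegative constant divided by the cost, so the order is reversed. *)
  assert (Hnu : forall x y, 0 < x -> 0 < y ->
    cost w (s * sqrt y) <= cost w (s * sqrt x) ->
    nu_mv T DeltaS BW gamma N QB xi_a eta x
    <= nu_mv T DeltaS BW gamma N QB xi_a eta y).
  { intros x y Hx Hy Hc.
    rewrite !nu_mv_substitution by assumption. fold s w.
    apply Rmult_le_compat_l.
    - apply Rmult_le_pos; [|nra].
      apply Rmult_le_pos; [apply Rmult_le_pos|]; lra.
    - apply Rinv_le_contravar; [|exact Hc].
      apply cost_pos, Rmult_lt_0_compat, sqrt_lt_R0; assumption. }
  apply round_by_optimal.
  - split; [nra|].
    rewrite <- (sqrt_sqrt (IZR m)) by lra. nra.
  (* Taking square roots and scaling by [s] carries [x <= y <= q ^ 2] to points up to [zeta]. *)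
  - intros x y Hx [Hxy Hyq]. apply Hnu; [lra..|].
    pose proof (sqrt_lt_R0 x Hx).
    apply sqrt_le_1_alt in Hxy, Hyq. rewrite Hsq in Hyq.
    apply (cost_ge_before w zeta); try assumption; nra.
  - intros x y [Hqx Hxy]. apply Hnu; [nra..|].
    apply sqrt_le_1_alt in Hxy, Hqx. rewrite Hsq in Hqx.
    apply (cost_le_after w zeta); try assumption; nra.
Qed.
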